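(* Let $(H,[-,-,-])$ be a commutative and cocommutative Hopf heap, and let $\alpha$ be an idempotent Hopf heap endomorphism of $H$ (i.e. $\alpha\circ\alpha=\alpha$). Define two binary operations on $H$ by $$x\cdot_\alpha y=[x_1,\alpha(x_2),y],\qquad x\cdot'_\alpha y=[x,\alpha(y_1),y_2]\qquad(x,y\in H).$$ Then $(H,[-,-,-],\cdot_\alpha)$ and $(H,[-,-,-],\cdot'_\alpha)$ are Hopf trusses.
   Context: Everything is over a fixed field $\mathbf{k}$. Sweedler notation $\Delta(c)=c_1\otimes c_2$ is used; $C^{cop}$ is the co-opposite coalgebra. All coalgebras are assumed to have at least one group-like element. A Hopf heap is a coalgebra $C$ with a coalgebra map $C\otimes C^{cop}\otimes C\to C$, $a\otimes b\otimes c\mapsto[a,b,c]$, such that $[[a,b,c],d,h]=[a,b,[c,d,h]]$ and $[c_1,c_2,a]=[a,c_1,c_2]=\varepsilon(c)a$ for all $a,b,c,d,h\in C$. It is commutative if $[x,y,z]=[z,y,x]$ for all $x,y,z$, and cocommutative if the coalgebra is. A Hopf heap homomorphism is a coalgebra map $f$ with $f([a,b,c])=[f(a),f(b),f(c)]$. A Hopf truss $(H,[-,-,-],\circ)$ is a Hopf heap $(H,[-,-,-])$ together with a multiplication $\circ$ making the same coalgebra a nonunital bialgebra $(H,\circ,\Delta,\varepsilon)$ (associative multiplication which is a coalgebra map, unit not required) such that $a\circ[b,c,d]=[a_1\circ b,a_2\circ c,a_3\circ d]$ for all $a,b,c,d\in H$. *)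

(* Defs.v *)
From HB Require Import structures.
From mathcomp Require Import all_boot all_order all_algebra.
From mathcomp Require Import boolp.

Set Implicit Arguments.
Unset Strict Implicit.
Unset Printing Implicit Defensive.

Import GRing.Theory.
Local Open Scope ring_scope.
Local Open Scope quotient_scope.

Reserved Notation "x \ox y" (at level 40, left associativity).
Reserved Notation "U \otimes V" (at level 40, left associativity).
Reserved Notation "\tsum_ ( x , y <- t ) F"
  (at level 41, F at level 41, x binder, y binder, t at level 41,
   format "'[' \tsum_ ( x ,  y  <-  t ) '/  '  F ']'").

Fact linear_map0 (k : fieldType) (U V : lmodType k) (f : U -> V) :
  linear f -> f 0 = 0.
Proof.
move=> lf; have := lf (-1) 0 0; rewrite scaler0 add0r => ->.
by rewrite scaleN1r addNr.
Qed.

(* The tensor product of two vector spaces of arbitrary dimension.  A sequence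
   [:: (u_1, v_1); ...; (u_n, v_n)] stands for the formal sum of the symbols
   u_i (x) v_i, and [tens_eq] is the congruence generated by the bilinearity
   relations.  Scalars need not be recorded, as a (u (x) v) = (a u) (x) v. *)
Section TensorRelation.
Variables (k : fieldType) (U V : lmodType k).
Implicit Types (s t : seq (U * V)).

Inductive tens_eq : seq (U * V) -> seq (U * V) -> Prop :=
| tens_eq_refl s : tens_eq s s
| tens_eq_sym s t : tens_eq s t -> tens_eq t s
| tens_eq_trans s t r : tens_eq s t -> tens_eq t r -> tens_eq s r
| tens_eq_cat s s' t t' :
    tens_eq s s' -> tens_eq t t' -> tens_eq (s ++ t) (s' ++ t')
| tens_eq_comm s t : tens_eq (s ++ t) (t ++ s)
| tens_eq_zero v : tens_eq [:: (0, v)] [::]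
| tens_eq_addl u u' v : tens_eq [:: (u + u', v)] [:: (u, v); (u', v)]
| tens_eq_addr u v v' : tens_eq [:: (u, v + v')] [:: (u, v); (u, v')]
| tens_eq_scale a u v : tens_eq [:: (a *: u, v)] [:: (u, a *: v)].

Definition tens_eqb s t : bool := `[< tens_eq s t >].

Fact tens_eqb_refl : reflexive tens_eqb.
Proof. by move=> s; apply/asboolP/tens_eq_refl. Qed.
Fact tens_eqb_sym : symmetric tens_eqb.
Proof.
by move=> s t; apply/idP/idP => /asboolP h; apply/asboolP/tens_eq_sym.
Qed.
Fact tens_eqb_trans : transitive tens_eqb.
Proof.
by move=> t s r /asboolP h /asboolP h'; apply/asboolP/(tens_eq_trans h h').
Qed.

Canonical tens_equiv := EquivRel tens_eqb tens_eqb_refl tens_eqb_sym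
  tens_eqb_trans.

Definition tens : Type := {eq_quot tens_equiv}.
HB.instance Definition _ := EqQuotient.on tens.
HB.instance Definition _ := Choice.on tens.

Definition tens_pi (s : seq (U * V)) : tens := \pi_tens s.

Lemma tens_piP s t : reflect (tens_eq s t) (tens_pi s == tens_pi t).
Proof.
by apply: (iffP eqP) => [/eqquotP/asboolP|h] //; apply/eqquotP/asboolP.
Qed.

Lemma tens_pi_eq s t : tens_eq s t -> tens_pi s = tens_pi t.
Proof. by move=> h; apply/eqP/tens_piP. Qed.

Lemma tens_repr (t : tens) : tens_pi (repr t) = t.
Proof. exact: reprK. Qed.

Lemma tens_pi_repr s : tens_eq (repr (tens_pi s)) s.
Proof. by apply/tens_piP; rewrite tens_repr. Qed.

Lemma tens_eq_map (f : U -> U) s t : linear f -> tens_eq s t ->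
  tens_eq [seq (f p.1, p.2) | p <- s] [seq (f p.1, p.2) | p <- t].
Proof.
move=> lf; have f0 := linear_map0 lf.
have fD u u' : f (u + u') = f u + f u'.
  by have := lf 1 u u'; rewrite !scale1r.
have fZ a u : f (a *: u) = a *: f u by have := lf a u 0; rewrite f0 !addr0.
elim=> /=.
- by move=> *; apply: tens_eq_refl.
- by move=> *; apply: tens_eq_sym.
- by move=> ? t' ? _ h _ h'; apply: tens_eq_trans h h'.
- by move=> *; rewrite !map_cat; apply: tens_eq_cat.
- by move=> *; rewrite !map_cat; apply: tens_eq_comm.
- by move=> v; rewrite f0; apply: tens_eq_zero.
- by move=> *; rewrite fD; apply: tens_eq_addl.
- by move=> *; apply: tens_eq_addr.
- by move=> *; rewrite fZ; apply: tens_eq_scale.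
Qed.

Definition tens_zero : tens := tens_pi [::].
Definition tens_add (x y : tens) : tens := tens_pi (repr x ++ repr y).
Definition tens_mapl (f : U -> U) (x : tens) : tens :=
  tens_pi [seq (f p.1, p.2) | p <- repr x].
Definition tens_opp : tens -> tens := tens_mapl -%R.
Definition tens_scale (a : k) : tens -> tens := tens_mapl ( *:%R a).

Lemma tens_add_pi s t : tens_add (tens_pi s) (tens_pi t) = tens_pi (s ++ t).
Proof. by apply/tens_pi_eq/tens_eq_cat; apply: tens_pi_repr. Qed.

Lemma tens_mapl_pi f s : linear f ->
  tens_mapl f (tens_pi s) = tens_pi [seq (f p.1, p.2) | p <- s].
Proof. by move=> lf; apply/tens_pi_eq/(tens_eq_map lf)/tens_pi_repr. Qed.

Fact linear_opp : linear (-%R : U -> U).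
Proof. by move=> a u v; rewrite opprD scalerN. Qed.
Fact linear_scale a : linear ( *:%R a : U -> U).
Proof. by move=> b u v; rewrite scalerDr !scalerA mulrC. Qed.

Fact tens_addA : associative tens_add.
Proof.
move=> x y z; rewrite -[x]tens_repr -[y]tens_repr -[z]tens_repr.
by rewrite !tens_add_pi catA.
Qed.
Fact tens_addC : commutative tens_add.
Proof. by move=> x y; apply/tens_pi_eq/tens_eq_comm. Qed.
Fact tens_add0 : left_id tens_zero tens_add.
Proof. by move=> x; rewrite -[x]tens_repr tens_add_pi. Qed.

Lemma tens_pi_cons p s :
  tens_pi (p :: s) = tens_add (tens_pi [:: p]) (tens_pi s).
Proof. by rewrite tens_add_pi. Qed.

Lemma tens_eq_merge (f g h : U -> U) s : (forall u, f u + g u = h u) ->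
  tens_add (tens_pi [seq (f p.1, p.2) | p <- s])
    (tens_pi [seq (g p.1, p.2) | p <- s]) = tens_pi [seq (h p.1, p.2) | p <- s].
Proof.
move=> fgh; elim: s => [|[u v] s IHs] /=; first by rewrite tens_add_pi.
rewrite (tens_pi_cons (f u, v)) (tens_pi_cons (g u, v)) (tens_pi_cons (h u, v)).
rewrite -IHs -fgh (tens_pi_eq (tens_eq_addl _ _ _)) (tens_pi_cons _ [:: _]).
by rewrite -!tens_addA; congr tens_add; rewrite tens_addC -!tens_addA;
  congr tens_add; rewrite tens_addC.
Qed.

Fact tens_addN : left_inverse tens_zero tens_opp tens_add.
Proof.
move=> x; rewrite -[x]tens_repr; move: (repr x) => s.
rewrite /tens_opp (tens_mapl_pi _ linear_opp).
have {2}-> : s = [seq (id p.1, p.2) | p <- s].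
  by rewrite -[LHS]map_id; apply: eq_map => -[].
have addN0 (u : U) : - u + id u = (fun=> 0) u by rewrite addNr.
rewrite (tens_eq_merge s addN0).
elim: s => //= -[u v] s IHs; rewrite tens_pi_cons IHs.
by rewrite (tens_pi_eq (tens_eq_zero _)) tens_add_pi.
Qed.

HB.instance Definition _ :=
  GRing.isZmodule.Build tens tens_addA tens_addC tens_add0 tens_addN.

Lemma tens_scale_pi a s :
  tens_scale a (tens_pi s) = tens_pi [seq (a *: p.1, p.2) | p <- s].
Proof. exact/tens_mapl_pi/linear_scale. Qed.

Fact tens_scaleA a b x : tens_scale a (tens_scale b x) = tens_scale (a * b) x.
Proof.
rewrite -[x]tens_repr; move: (repr x) => s.
rewrite (tens_scale_pi b) 2!tens_scale_pi -map_comp.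
by congr tens_pi; apply: eq_map => -[u v] /=; rewrite scalerA.
Qed.
Fact tens_scale1 : left_id 1 tens_scale.
Proof.
move=> x; rewrite -[RHS]tens_repr; congr tens_pi.
by rewrite -[RHS]map_id; apply: eq_map => -[u v] /=; rewrite scale1r.
Qed.
Fact tens_scaleDr : right_distributive tens_scale +%R.
Proof.
move=> a x y; rewrite -[x]tens_repr -[y]tens_repr.
rewrite [in LHS]/GRing.add [in RHS]/GRing.add /= tens_add_pi.
by rewrite !tens_scale_pi tens_add_pi map_cat.
Qed.
Fact tens_scaleDl x : {morph tens_scale^~ x : a b / a + b}.
Proof.
move=> a b; rewrite [in RHS]/GRing.add /= -[x]tens_repr.
rewrite !tens_scale_pi; apply/esym/tens_eq_merge => u.
by rewrite scalerDl.
Qed.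

HB.instance Definition _ := GRing.Zmodule_isLmodule.Build k tens
  tens_scaleA tens_scale1 tens_scaleDr tens_scaleDl.

Definition tensor (u : U) (v : V) : tens := tens_pi [:: (u, v)].

End TensorRelation.

Notation "U \otimes V" := (tens U V).
Notation "u \ox v" := (tensor u v) : ring_scope.

(* [\tsum_(x, y <- t) F x y] is Sweedler notation: if t = \sum_i x_i \ox y_i
   then it denotes \sum_i F x_i y_i.  It is computed on a chosen representative
   of t; when F is bilinear the choice is irrelevant ([tlift_sum]) and [tlift F]
   is the linear map induced by F ([tlift_linear], [tliftE]). *)
Definition tlift (k : fieldType) (U V W : lmodType k) (F : U -> V -> W)
  (t : U \otimes V) : W := \sum_(p <- repr t) F p.1 p.2.

Notation "\tsum_ ( x , y <- t ) F" := (tlift (fun x y => F) t) : ring_scope.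

Notation bilinear_map F := (bilinear_for *:%R *:%R F).

Section TensorTheory.
Variables (k : fieldType) (U V W : lmodType k).

Lemma tensorDl u u' v : (u + u') \ox v = u \ox v + u' \ox v :> U \otimes V.
Proof.
rewrite [in RHS]/GRing.add /= tens_add_pi.
exact/tens_pi_eq/tens_eq_addl.
Qed.

Lemma tensorDr u v v' : u \ox (v + v') = u \ox v + u \ox v' :> U \otimes V.
Proof.
rewrite [in RHS]/GRing.add /= tens_add_pi.
exact/tens_pi_eq/tens_eq_addr.
Qed.

Lemma tensorZl a u v : (a *: u) \ox v = a *: (u \ox v) :> U \otimes V.
Proof.
by rewrite [in RHS]/GRing.scale /= tens_scale_pi.
Qed.

Lemma tensorZr a u v : u \ox (a *: v) = a *: (u \ox v) :> U \otimes V.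
Proof. by rewrite -tensorZl; apply/esym/tens_pi_eq/tens_eq_scale. Qed.

Lemma tensor_bilinear : bilinear_map (@tensor k U V).
Proof.
split=> [v|u] a x y; first by rewrite tensorDl tensorZl.
by rewrite tensorDr tensorZr.
Qed.

Lemma tensor0l v : 0 \ox v = 0 :> U \otimes V.
Proof. by rewrite -(scale0r 0) tensorZl scale0r. Qed.

Lemma tensor0r u : u \ox 0 = 0 :> U \otimes V.
Proof. by rewrite -(scale0r 0) tensorZr scale0r. Qed.

Lemma tens_pi_sum (s : seq (U * V)) : tens_pi s = \sum_(p <- s) p.1 \ox p.2.
Proof.
elim: s => [|[u v] s IHs]; first by rewrite big_nil.
by rewrite big_cons -IHs tens_pi_cons.
Qed.

Lemma tensor_repr (t : U \otimes V) : t = \sum_(p <- repr t) p.1 \ox p.2.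
Proof. by rewrite -tens_pi_sum tens_repr. Qed.

Lemma tensor_ind (P : U \otimes V -> Prop) :
  P 0 -> (forall u v t, P t -> P (u \ox v + t)) -> forall t, P t.
Proof.
move=> P0 PD t; rewrite [t]tensor_repr.
by elim: (repr t) => [|p s IHs]; rewrite ?big_nil // big_cons; apply: PD.
Qed.

Lemma tlift_eq (F : U -> V -> W) (s t : seq (U * V)) : bilinear_map F ->
  tens_eq s t -> \sum_(p <- s) F p.1 p.2 = \sum_(p <- t) F p.1 p.2.
Proof.
move=> [lF rF].
have F0 v : F 0 v = 0 := linear_map0 (lF v).
have F0r u : F u 0 = 0 := linear_map0 (rF u).
elim=> //=.
- by move=> s1 t1 r1 _ -> _ ->.
- by move=> s1 s2 t1 t2 _ e _ e'; rewrite !big_cat /= e e'.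
- by move=> s1 t1; rewrite !big_cat /= addrC.
- by move=> v; rewrite big_seq1 big_nil F0.
- move=> u u' v; rewrite !big_cons !big_nil /= !addr0.
  by have := lF v 1 u u'; rewrite /= !scale1r.
- move=> u v v'; rewrite !big_cons !big_nil /= !addr0.
  by have := rF u 1 v v'; rewrite /= !scale1r.
- move=> a u v; rewrite !big_seq1 /=.
  have := lF v a u 0; rewrite /= F0 !addr0 => ->.
  by have := rF u a v 0; rewrite /= F0r !addr0 => ->.
Qed.

Variable F : U -> V -> W.
Hypothesis bF : bilinear_map F.

Lemma tlift_pi s : tlift F (tens_pi s) = \sum_(p <- s) F p.1 p.2.
Proof. exact/tlift_eq/tens_pi_repr. Qed.

Lemma tliftE u v : tlift F (u \ox v) = F u v.
Proof. by rewrite tlift_pi big_seq1. Qed.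

Lemma tlift_sum s :
  tlift F (\sum_(p <- s) p.1 \ox p.2) = \sum_(p <- s) F p.1 p.2.
Proof. by rewrite -tens_pi_sum tlift_pi. Qed.

Lemma tlift_linear : linear (tlift F).
Proof.
move=> a x y; rewrite -[x]tens_repr -[y]tens_repr.
rewrite {1}/GRing.scale /= tens_scale_pi.
rewrite {1}/GRing.add /= tens_add_pi !tlift_pi big_cat /= big_map /=.
congr (_ + _); rewrite scaler_sumr; apply: eq_bigr => -[u v] _ /=.
have F0 : F 0 v = 0 := linear_map0 (bF.1 v).
by have := bF.1 v a u 0; rewrite /= F0 !addr0 => ->.
Qed.

Lemma tlift0 : tlift F 0 = 0.
Proof. exact: (linear_map0 tlift_linear). Qed.

Lemma tliftD x y : tlift F (x + y) = tlift F x + tlift F y.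
Proof. by have := tlift_linear 1 x y; rewrite !scale1r. Qed.

End TensorTheory.

Lemma tensor_ext (k : fieldType) (U V W : lmodType k)
    (f g : {linear U \otimes V -> W}) :
  (forall u v, f (u \ox v) = g (u \ox v)) -> f =1 g.
Proof.
move=> fg; apply: tensor_ind => [|u v t IHt]; first by rewrite !linear0.
by rewrite !linearD fg IHt.
Qed.

Definition tmap (k : fieldType) (U U' V V' : lmodType k)
    (f : U -> U') (g : V -> V') (t : U \otimes V) : U' \otimes V' :=
  \tsum_(u, v <- t) f u \ox g v.

Definition tswap (k : fieldType) (U V : lmodType k) (t : U \otimes V) :
    V \otimes U :=
  \tsum_(u, v <- t) v \ox u.

Definition tassoc (k : fieldType) (U V W : lmodType k)
    (t : (U \otimes V) \otimes W) :
    U \otimes (V \otimes W) :=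
  \tsum_(s, w <- t) \tsum_(u, v <- s) u \ox (v \ox w).

(* (U (x) U') (x) (V (x) V') -> (U (x) V) (x) (U' (x) V'), exchanging the two
   middle factors. *)
Definition tmid (k : fieldType) (U U' V V' : lmodType k)
    (t : (U \otimes U') \otimes (V \otimes V')) :
    (U \otimes V) \otimes (U' \otimes V') :=
  \tsum_(s, r <- t) \tsum_(u, u' <- s) \tsum_(v, v' <- r)
    (u \ox v) \ox (u' \ox v').

Section TensorMaps.
Variable k : fieldType.
Implicit Types U V W : lmodType k.

Fact tmap_bilinear U U' V V' (f : {linear U -> U'}) (g : {linear V -> V'}) :
  bilinear_map (fun u v => f u \ox g v).
Proof.
by split=> [v|u] a x y; rewrite linearP ?tensorDl ?tensorZl ?tensorDr ?tensorZr.
Qed.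
HB.instance Definition _ U U' V V' (f : {linear U -> U'})
    (g : {linear V -> V'}) :=
  GRing.isLinear.Build k (U \otimes V) (U' \otimes V') *:%R (tmap f g)
    (tlift_linear (tmap_bilinear f g)).
Lemma tmapE U U' V V' (f : {linear U -> U'}) (g : {linear V -> V'}) u v :
  tmap f g (u \ox v) = f u \ox g v.
Proof. exact/tliftE/tmap_bilinear. Qed.

Fact tswap_bilinear U V : bilinear_map (fun (u : U) (v : V) => v \ox u).
Proof.
by split=> [v|u] a x y; rewrite ?tensorDl ?tensorZl ?tensorDr ?tensorZr.
Qed.
HB.instance Definition _ U V :=
  GRing.isLinear.Build k (U \otimes V) (V \otimes U) *:%R (@tswap k U V)
    (tlift_linear (@tswap_bilinear U V)).
Lemma tswapE U V (u : U) (v : V) : tswap (u \ox v) = v \ox u.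
Proof. exact/tliftE/tswap_bilinear. Qed.

(* A map that is linear in u, v and w separately induces a map that is bilinear
   in the element of U (x) V and w. *)
Lemma tlift_bilinear U V W W' (F : U -> V -> W -> W') :
  (forall w, bilinear_map (fun u v => F u v w)) ->
  (forall u v, linear (F u v)) ->
  bilinear_map (fun s w => \tsum_(u, v <- s) F u v w).
Proof.
move=> bF lF; split=> [w|s]; first exact: (tlift_linear (bF w)).
move=> a x y; rewrite /= /tlift scaler_sumr -big_split.
by apply: eq_bigr => p _; rewrite lF.
Qed.

Fact tassoc_bilinear1 U V W (w : W) :
  bilinear_map (fun (u : U) (v : V) => u \ox (v \ox w)).
Proof.
by split=> [v|u] a x y; rewrite ?tensorDl ?tensorZl ?tensorDr ?tensorZr.
Qed.
Fact tassoc_bilinear U V W :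
  bilinear_map (fun (s : U \otimes V) (w : W) =>
    \tsum_(u, v <- s) u \ox (v \ox w)).
Proof.
apply: tlift_bilinear; first exact: tassoc_bilinear1.
by move=> u v a x y; rewrite !tensorDr !tensorZr.
Qed.
HB.instance Definition _ U V W :=
  GRing.isLinear.Build k (U \otimes V \otimes W) (U \otimes (V \otimes W)) *:%R
    (@tassoc k U V W) (tlift_linear (@tassoc_bilinear U V W)).
Lemma tassocE U V W (u : U) (v : V) (w : W) :
  tassoc (u \ox v \ox w) = u \ox (v \ox w).
Proof.
rewrite [LHS](tliftE (@tassoc_bilinear U V W)).
exact: (tliftE (@tassoc_bilinear1 U V W w)).
Qed.

Fact tmid_bilinear1 U U' V V' (u : U) (u' : U') :
  bilinear_map (fun (v : V) (v' : V') => (u \ox v) \ox (u' \ox v')).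
Proof.
by split=> [v|v'] a x y;
  rewrite ?(tensorDr, tensorZr, tensorDl, tensorZl).
Qed.
Fact tmid_bilinear2 U U' V V' (r : V \otimes V') :
  bilinear_map (fun (u : U) (u' : U') =>
    \tsum_(v, v' <- r) (u \ox v) \ox (u' \ox v')).
Proof.
by split=> [u'|u] a x y; rewrite /= /tlift scaler_sumr -big_split;
  apply: eq_bigr => p _; rewrite ?(tensorDr, tensorZr, tensorDl, tensorZl).
Qed.
Fact tmid_bilinear U U' V V' :
  bilinear_map (fun (s : U \otimes U') (r : V \otimes V') =>
    \tsum_(u, u' <- s) \tsum_(v, v' <- r) (u \ox v) \ox (u' \ox v')).
Proof.
apply: tlift_bilinear; first exact: tmid_bilinear2.
by move=> u u'; exact: (tlift_linear (@tmid_bilinear1 U U' V V' u u')).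
Qed.
HB.instance Definition _ U U' V V' :=
  GRing.isLinear.Build k ((U \otimes U') \otimes (V \otimes V'))
    ((U \otimes V) \otimes (U' \otimes V'))
    *:%R (@tmid k U U' V V') (tlift_linear (@tmid_bilinear U U' V V')).
Lemma tmidE U U' V V' (u : U) (u' : U') (v : V) (v' : V') :
  tmid ((u \ox u') \ox (v \ox v')) = (u \ox v) \ox (u' \ox v').
Proof.
rewrite [LHS](tliftE (@tmid_bilinear U U' V V')).
rewrite (tliftE (@tmid_bilinear2 U U' V V' (v \ox v'))).
exact: (tliftE (@tmid_bilinear1 U U' V V' u u')).
Qed.

Fact tscale_bilinearl U V (e : {scalar U}) :
  bilinear_map (fun (u : U) (v : V) => e u *: v).
Proof.
split=> [v|u] a x y; first by rewrite /= linearP scalerDl scalerA.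
by rewrite /= scalerDr !scalerA mulrC.
Qed.
Fact tscale_bilinearr U V (e : {scalar V}) :
  bilinear_map (fun (u : U) (v : V) => e v *: u).
Proof.
split=> [v|u] a x y; last by rewrite /= linearP scalerDl scalerA.
by rewrite /= scalerDr !scalerA mulrC.
Qed.

End TensorMaps.

HB.mixin Record Lmodule_isCoalgebra (k : fieldType) C of GRing.Lmodule k C := {
  comul : {linear C -> C \otimes C};
  counit : {scalar C};
  coassoc : forall c, tassoc (tmap comul idfun (comul c)) =
                      tmap idfun comul (comul c);
  counitl : forall c, \tsum_(c1, c2 <- comul c) counit c1 *: c2 = c;
  counitr : forall c, \tsum_(c1, c2 <- comul c) counit c2 *: c1 = c
}.

#[short(type="coalgType")]
HB.structure Definition Coalgebra (k : fieldType) :=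
  { C of Lmodule_isCoalgebra k C & GRing.Lmodule k C }.

Definition coalg_morph (k : fieldType) (C D : coalgType k)
    (f : {linear C -> D}) : Prop :=
  (forall c : C, comul (f c) = tmap f f (comul c)) /\
  (forall c : C, counit (f c) = counit c).

Definition cocommutative (k : fieldType) (C : coalgType k) : Prop :=
  forall c : C, tswap (comul c) = comul c.

Definition grouplike (k : fieldType) (C : coalgType k) (g : C) : Prop :=
  comul g = g \ox g /\ counit g = 1.

Section CoOpposite.
Variables (k : fieldType) (C : coalgType k).

Definition cop_comul (c : C) : C \otimes C := tswap (comul c).

Fact cop_comul_linear : linear cop_comul.
Proof. by move=> a x y; rewrite /cop_comul !linearP. Qed.
HB.instance Definition _ :=
  GRing.isLinear.Build k C (C \otimes C) *:%R cop_comul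
    cop_comul_linear.

Fact cop_coassoc c : tassoc (tmap cop_comul idfun (cop_comul c)) =
  tmap idfun cop_comul (cop_comul c).
Proof.
have e1 (t : C \otimes C) : tassoc (tmap cop_comul idfun (tswap t)) =
    tassoc (tswap (tmap idfun (@tswap k C C) (tmap idfun comul t))).
  elim/tensor_ind: t => [|u v t IHt]; first by rewrite !linear0.
  by rewrite !linearD /= IHt tswapE !tmapE tswapE.
have e2 (t : C \otimes C) : tmap idfun cop_comul (tswap t) =
    tswap (tmap (@tswap k C C) idfun (tmap comul idfun t)).
  elim/tensor_ind: t => [|u v t IHt]; first by rewrite !linear0.
  by rewrite !linearD /= IHt tswapE !tmapE tswapE.
have e3 (t : (C \otimes C) \otimes C) : 
    tassoc (tswap (tmap idfun (@tswap k C C) (tassoc t))) =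
    tswap (tmap (@tswap k C C) idfun t).
  elim/tensor_ind: t => [|u v t IHt]; first by rewrite !linear0.
  rewrite !linearD /= IHt; congr (_ + _).
  elim/tensor_ind: u => [|u u' s IHs].
    by rewrite tensor0l !linear0.
  by rewrite tensorDl !linearD /= IHs tassocE !tmapE /= !tswapE tassocE.
by rewrite [LHS]e1 [RHS]e2 -e3 coassoc.
Qed.

Fact cop_counitl c :
  \tsum_(c1, c2 <- cop_comul c) counit c1 *: c2 = c.
Proof.
rewrite -[RHS]counitr /cop_comul; move: (comul _) => t.
elim/tensor_ind: t => [|u v t IHt].
  rewrite linear0 /= (tlift0 (tscale_bilinearl _ _)).
  by rewrite (tlift0 (tscale_bilinearr _ _)).
rewrite linearD /= (tliftD (tscale_bilinearl _ _)).
rewrite (tliftD (tscale_bilinearr _ _)).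
rewrite IHt tswapE (tliftE (tscale_bilinearl _ _)).
by rewrite (tliftE (tscale_bilinearr _ _)).
Qed.

Fact cop_counitr c :
  \tsum_(c1, c2 <- cop_comul c) counit c2 *: c1 = c.
Proof.
rewrite -[RHS]counitl /cop_comul; move: (comul _) => t.
elim/tensor_ind: t => [|u v t IHt].
  rewrite linear0 /= (tlift0 (tscale_bilinearl _ _)).
  by rewrite (tlift0 (tscale_bilinearr _ _)).
rewrite linearD /= (tliftD (tscale_bilinearl _ _)).
rewrite (tliftD (tscale_bilinearr _ _)).
rewrite IHt tswapE (tliftE (tscale_bilinearl _ _)).
by rewrite (tliftE (tscale_bilinearr _ _)).
Qed.

Definition cop : Type := C.
HB.instance Definition _ := GRing.Lmodule.copy cop C.
HB.instance Definition _ := Lmodule_isCoalgebra.Build k cop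
  cop_coassoc cop_counitl cop_counitr.

End CoOpposite.

Section TensorCoalgebra.
Variables (k : fieldType) (C D : coalgType k).

Definition tens_comul (t : C \otimes D) : (C \otimes D) \otimes (C \otimes D) :=
  tmid (tmap comul comul t).

Definition tens_counit (t : C \otimes D) : k :=
  @tlift k C D k^o (fun c d => counit c * counit d) t.

Fact tens_comul_linear : linear tens_comul.
Proof. by move=> a x y; rewrite /tens_comul !linearP. Qed.
HB.instance Definition _ :=
  GRing.isLinear.Build k (C \otimes D)
    ((C \otimes D) \otimes (C \otimes D)) *:%R
    tens_comul tens_comul_linear.

Fact tens_counit_bilinear :
  @bilinear_for k C D k^o *:%R *:%R (fun c d => counit c * counit d).
Proof.
split=> [d|c] a x y /=; rewrite linearP /=; first by rewrite mulrDl -mulrA.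
by rewrite mulrDr mulrCA.
Qed.
Fact tens_counit_linear : scalar tens_counit.
Proof. exact: (tlift_linear tens_counit_bilinear). Qed.
HB.instance Definition _ :=
  GRing.isLinear.Build k (C \otimes D) k *%R tens_counit tens_counit_linear.

Lemma tens_counitE c d : tens_counit (c \ox d) = counit c * counit d.
Proof. exact: (tliftE tens_counit_bilinear). Qed.

Let U := C \otimes D.

(* ((C (x) C) (x) C) (x) ((D (x) D) (x) D) -> (U (x) U) (x) U, and its
   counterpart for the other bracketing *)
Let mid3l (t : (C \otimes C \otimes C) \otimes (D \otimes D \otimes D)) :
  U \otimes U \otimes U := tmap (@tmid k C C D D) idfun (tmid t).
Let mid3r (t : (C \otimes (C \otimes C)) \otimes (D \otimes (D \otimes D))) :
  U \otimes (U \otimes U) := tmap idfun (@tmid k C C D D) (tmid t).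

Local Lemma tens_coassocl (x : C \otimes C) (y : D \otimes D) :
  tmap tens_comul idfun (tmid (x \ox y)) =
  mid3l (tmap comul idfun x \ox tmap comul idfun y).
Proof.
rewrite /mid3l; elim/tensor_ind: x => [|c c' x IHx].
  by rewrite linear0 /= !tensor0l !linear0.
rewrite linearD /= !tensorDl !linearD /= IHx; congr (_ + _) => {x IHx}.
elim/tensor_ind: y => [|d d' y IHy].
  by rewrite linear0 /= !tensor0r !linear0.
rewrite linearD /= !tensorDr !linearD /= IHy; congr (_ + _).
by rewrite tmidE !tmapE /= tmidE tmapE /= /tens_comul tmapE.
Qed.

Local Lemma tens_coassocr (x : C \otimes C) (y : D \otimes D) :
  tmap idfun tens_comul (tmid (x \ox y)) =
  mid3r (tmap idfun comul x \ox tmap idfun comul y).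
Proof.
rewrite /mid3r; elim/tensor_ind: x => [|c c' x IHx].
  by rewrite linear0 /= !tensor0l !linear0.
rewrite linearD /= !tensorDl !linearD /= IHx; congr (_ + _) => {x IHx}.
elim/tensor_ind: y => [|d d' y IHy].
  by rewrite linear0 /= !tensor0r !linear0.
rewrite linearD /= !tensorDr !linearD /= IHy; congr (_ + _).
by rewrite tmidE !tmapE /= tmidE tmapE /= /tens_comul tmapE.
Qed.

Local Lemma mid3_assoc (x : C \otimes C \otimes C) (y : D \otimes D \otimes D) :
  tassoc (mid3l (x \ox y)) = mid3r (tassoc x \ox tassoc y).
Proof.
rewrite /mid3l /mid3r; elim/tensor_ind: x => [|cc c x IHx].
  by rewrite linear0 /= !tensor0l !linear0.
rewrite linearD /= !tensorDl !linearD /= IHx; congr (_ + _) => {x IHx}.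
elim/tensor_ind: y => [|dd d y IHy].
  by rewrite linear0 /= !tensor0r !linear0.
rewrite linearD /= !tensorDr !linearD /= IHy; congr (_ + _) => {y IHy}.
elim/tensor_ind: cc => [|c1 c2 cc IHc].
  by rewrite !(tensor0l, linear0).
rewrite !(tensorDl, linearD) /= IHc.
congr (_ + _) => {cc IHc}.
elim/tensor_ind: dd => [|d1 d2 dd IHd].
  by rewrite !(tensor0l, tensor0r, linear0).
rewrite tensorDl !(tensorDr, linearD) /= IHd.
congr (_ + _) => {dd IHd}.
by rewrite !tassocE !tmidE !tmapE /= !tmidE tassocE.
Qed.

Fact tens_coassoc t : tassoc (tmap tens_comul idfun (tens_comul t)) =
  tmap idfun tens_comul (tens_comul t).
Proof.
elim/tensor_ind: t => [|c d t IHt]; first by rewrite !linear0.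
rewrite !linearD /= IHt; congr (_ + _); rewrite {2 4}/tens_comul tmapE.
by rewrite tens_coassocl tens_coassocr mid3_assoc !coassoc.
Qed.

Fact tens_counitl t :
  \tsum_(t1, t2 <- tens_comul t) tens_counit t1 *: t2 = t.
Proof.
elim/tensor_ind: t => [|c d t IHt].
  by rewrite linear0 /= (tlift0 (tscale_bilinearl _ _)).
rewrite linearD /= (tliftD (tscale_bilinearl _ _)) IHt; congr (_ + _).
rewrite /tens_comul tmapE -[in RHS](counitl c) -[in RHS](counitl d).
move: (comul c) (comul d) => x y.
elim/tensor_ind: x => [|c1 c2 x IHx].
  rewrite tensor0l linear0 /= (tlift0 (tscale_bilinearl _ _)).
  by rewrite (tlift0 (tscale_bilinearl _ _)) tensor0l.
rewrite tensorDl linearD /= !(tliftD (tscale_bilinearl _ _)) IHx tensorDl.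
congr (_ + _) => {x IHx}; rewrite (tliftE (tscale_bilinearl _ _)).
elim/tensor_ind: y => [|d1 d2 y IHy].
  rewrite tensor0r linear0 /= (tlift0 (tscale_bilinearl _ _)).
  by rewrite (tlift0 (tscale_bilinearl _ _)) tensor0r.
rewrite tensorDr linearD /= !(tliftD (tscale_bilinearl _ _)) IHy tensorDr.
congr (_ + _); rewrite tmidE !(tliftE (tscale_bilinearl _ _)) /=.
by rewrite tens_counitE tensorZl tensorZr scalerA.
Qed.

Fact tens_counitr t :
  \tsum_(t1, t2 <- tens_comul t) tens_counit t2 *: t1 = t.
Proof.
elim/tensor_ind: t => [|c d t IHt].
  by rewrite linear0 /= (tlift0 (tscale_bilinearr _ _)).
rewrite linearD /= (tliftD (tscale_bilinearr _ _)) IHt; congr (_ + _).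
rewrite /tens_comul tmapE -[in RHS](counitr c) -[in RHS](counitr d).
move: (comul c) (comul d) => x y.
elim/tensor_ind: x => [|c1 c2 x IHx].
  rewrite tensor0l linear0 /= (tlift0 (tscale_bilinearr _ _)).
  by rewrite (tlift0 (tscale_bilinearr _ _)) tensor0l.
rewrite tensorDl linearD /= !(tliftD (tscale_bilinearr _ _)) IHx tensorDl.
congr (_ + _) => {x IHx}; rewrite (tliftE (tscale_bilinearr _ _)).
elim/tensor_ind: y => [|d1 d2 y IHy].
  rewrite tensor0r linear0 /= (tlift0 (tscale_bilinearr _ _)).
  by rewrite (tlift0 (tscale_bilinearr _ _)) tensor0r.
rewrite tensorDr linearD /= !(tliftD (tscale_bilinearr _ _)) IHy tensorDr.
congr (_ + _); rewrite tmidE !(tliftE (tscale_bilinearr _ _)) /=.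
by rewrite tens_counitE tensorZl tensorZr scalerA.
Qed.

HB.instance Definition _ := Lmodule_isCoalgebra.Build k (C \otimes D)
  tens_coassoc tens_counitl tens_counitr.

End TensorCoalgebra.

Section HopfHeap.
Variables (k : fieldType) (H : coalgType k).

Notation bracket_map := {linear H \otimes cop H \otimes H -> H}.

(* [hb br a b c] is the bracket [a, b, c]. *)
Definition hb (br : bracket_map) (a b c : H) : H :=
  br (a \ox (b : cop H) \ox c).

Record hopf_heap (br : bracket_map) : Prop := HopfHeap {
  hopf_heap_coalg : coalg_morph br;
  hopf_heap_assoc : forall a b c d e : H,
    hb br (hb br a b c) d e = hb br a b (hb br c d e);
  hopf_heap_malcevl : forall c a : H,
    \tsum_(c1, c2 <- comul c) hb br c1 c2 a = counit c *: a;
  hopf_heap_malcevr : forall c a : H,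
    \tsum_(c1, c2 <- comul c) hb br a c1 c2 = counit c *: a
}.

Definition heap_commutative (br : bracket_map) : Prop :=
  forall x y z : H, hb br x y z = hb br z y x.

Record nonunital_bialgebra (op : H -> H -> H) : Prop := NonunitalBialgebra {
  nonunital_bialgebra_assoc : associative op;
  nonunital_bialgebra_coalg : exists2 m : {linear H \otimes H -> H},
    coalg_morph m & forall x y : H, m (x \ox y) = op x y
}.

Record hopf_truss (br : bracket_map) (op : H -> H -> H) : Prop := HopfTruss {
  hopf_truss_heap : hopf_heap br;
  hopf_truss_bialgebra : nonunital_bialgebra op;
  (* with Delta(a) = s (x) a3 and Delta(s) = a1 (x) a2 *)
  hopf_truss_distr : forall a b c d : H,
    op a (hb br b c d) =
    \tsum_(s, a3 <- comul a) \tsum_(a1, a2 <- comul s)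
      hb br (op a1 b) (op a2 c) (op a3 d)
}.

Definition alpha_mull (br : bracket_map) (alpha : H -> H) (x y : H) : H :=
  \tsum_(x1, x2 <- comul x) hb br x1 (alpha x2) y.

Definition alpha_mulr (br : bracket_map) (alpha : H -> H) (x y : H) : H :=
  \tsum_(y1, y2 <- comul y) hb br x (alpha y1) y2.

End HopfHeap.

Definition hopf_heap_morph (k : fieldType) (C D : coalgType k)
    (brC : {linear C \otimes cop C \otimes C -> C})
    (brD : {linear D \otimes cop D \otimes D -> D})
    (f : {linear C -> D}) : Prop :=
  coalg_morph f /\
  (forall a b c : C, f (hb brC a b c) = hb brD (f a) (f b) (f c)).

(* Main.v *)
(* Coalgebra morphisms into a cocommutative coalgebra behave like generalised
   elements: tensor products of cocommutative coalgebras are categorical products,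
   so for every cocommutative T a commutative cocommutative Hopf heap H induces an
   ordinary abelian heap (an abelian group without chosen origin) on the set of
   coalgebra morphisms T -> H.  On generalised elements the product of alpha_mull
   is f . g = [f, alpha f, g], and the truss axioms become identities in abelian
   heaps; the Sweedler sums are recovered by taking T to be a tensor power of H and
   evaluating on pure tensors.  By commutativity and cocommutativity alpha_mulr is
   the opposite of alpha_mull. *)
Require Import Defs.
From HB Require Import structures.
From mathcomp Require Import all_boot all_order all_algebra.
From mathcomp Require Import boolp.

Import GRing.Theory.
Local Open Scope ring_scope.

Set Implicit Arguments.
Unset Strict Implicit.

(** * Abelian heaps *)

Section AbelianHeap.
Variables (X : Type) (h : X -> X -> X -> X).
Hypothesis hA : forall a b c d e, h (h a b c) d e = h a b (h c d e).
Hypothesis hC : forall a b c, h a b c = h c b a.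
Hypothesis hK : forall a b, h a a b = b.

Lemma heapKr a b : h b a a = b.
Proof. by rewrite hC hK. Qed.

(** Reading h a b c as a - b + c, a bracket in the middle slot is subtracted term by term. The proof
    rewrites a as a bracket ending in h b c d, which then cancels against the middle slot. *)
Lemma heap_mid a b c d e : h a (h b c d) e = h (h a d c) b e.
Proof.
have {1}-> : a = h (h a d c) b (h b c d).
  by rewrite hA -(hA c) heapKr hK heapKr.
by rewrite hA hK.
Qed.

Lemma heap_swap_neg a b c d e : h (h a b c) d e = h (h a d c) b e.
Proof. by rewrite -!heap_mid (hC b). Qed.

Lemma heap_swap_pair a b c d e : h (h a b c) d e = h (h a d e) b c.
Proof. by rewrite heap_swap_neg hA (hC c) -hA. Qed.

(** In a 3 by 3 array, bracketing rows first or columns first gives the same result: both sides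
    flatten to the alternating sum in which a, c, e, x, z are positive and b, d, f, y negative. *)
Lemma heap_interchange a b c d e f x y z :
  h (h a b c) (h d e f) (h x y z) = h (h a d x) (h b e y) (h c f z).
Proof.
rewrite !heap_mid -!(hA _ _ x) -!(hA _ _ c).
rewrite (heap_swap_pair _ f e d x) (heap_swap_pair a b c d x).
by rewrite (heap_swap_neg _ f e y z) (heap_swap_pair _ b c y e).
Qed.

Variable al : X -> X.
Hypothesis al_heap : forall a b c, al (h a b c) = h (al a) (al b) (al c).
Hypothesis al_idem : forall a, al (al a) = al a.

Local Notation mul a b := (h a (al a) b).

(** Idempotence gives al (mul a b) = al b: the first two terms of the bracket collapse under al.
    What remains is heap associativity. *)
Lemma heap_mulA a b c : mul a (mul b c) = mul (mul a b) c.
Proof. by rewrite al_heap al_idem hK hA. Qed.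

(** Interchange turns the right side into a bracket of brackets, where those of three equal entries
    a and al a collapse. *)
Lemma heap_mulDr a b c d : mul a (h b c d) = h (mul a b) (mul a c) (mul a d).
Proof. by rewrite heap_interchange !hK. Qed.

(** This is left distributivity of the opposite product, needed for [alpha_mulr]. *)
Lemma heap_mulDl a b c d : mul (h b c d) a = h (mul b a) (mul c a) (mul d a).
Proof. by rewrite heap_interchange hK al_heap. Qed.

End AbelianHeap.

(** * Linear maps on iterated tensor products *)

Section TensorExtensionality.
Variable k : fieldType.
Implicit Types U V W X Y : lmodType k.

Lemma tensorl_ext U V W X (f g : {linear U \otimes V \otimes W -> X}) :
  (forall u v w, f (u \ox v \ox w) = g (u \ox v \ox w)) -> f =1 g.
Proof.
move=> fg; apply: tensor_ext => s w.
elim/tensor_ind: s => [|u v s IHs]; first by rewrite tensor0l !linear0.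
by rewrite tensorDl !linearD fg IHs.
Qed.

Lemma tensorr_ext U V W X (f g : {linear U \otimes (V \otimes W) -> X}) :
  (forall u v w, f (u \ox (v \ox w)) = g (u \ox (v \ox w))) -> f =1 g.
Proof.
move=> fg; apply: tensor_ext => u s.
elim/tensor_ind: s => [|v w s IHs]; first by rewrite tensor0r !linear0.
by rewrite tensorDr !linearD fg IHs.
Qed.

Lemma tensorlr_ext U U' V V' X
    (f g : {linear (U \otimes U') \otimes (V \otimes V') -> X}) :
  (forall u u' v v', f (u \ox u' \ox (v \ox v')) = g (u \ox u' \ox (v \ox v'))) ->
  f =1 g.
Proof.
move=> fg; apply: tensor_ext => s r.
elim/tensor_ind: s => [|u u' s IHs]; first by rewrite tensor0l !linear0.
rewrite tensorDl !linearD IHs; congr (_ + _) => {s IHs}.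
elim/tensor_ind: r => [|v v' r IHr]; first by rewrite tensor0r !linear0.
by rewrite tensorDr !linearD IHr fg.
Qed.

Lemma tensorrl_ext U V V' W X (f g : {linear U \otimes (V \otimes V' \otimes W) -> X}) :
  (forall u v v' w, f (u \ox (v \ox v' \ox w)) = g (u \ox (v \ox v' \ox w))) ->
  f =1 g.
Proof.
move=> fg; apply: tensorr_ext => u s w.
elim/tensor_ind: s => [|v v' s IHs]; first by rewrite tensor0l tensor0r !linear0.
by rewrite tensorDl tensorDr !linearD fg IHs.
Qed.

Lemma tensor6_ext U U' V V' W W' X
    (f g : {linear (U \otimes U') \otimes (V \otimes V') \otimes (W \otimes W') -> X}) :
  (forall u u' v v' w w', f (u \ox u' \ox (v \ox v') \ox (w \ox w')) =
     g (u \ox u' \ox (v \ox v') \ox (w \ox w'))) -> f =1 g.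
Proof.
move=> fg; apply: tensorl_ext => x y z.
elim/tensor_ind: x => [|u u' x IHx]; first by rewrite !tensor0l !linear0.
rewrite !tensorDl !linearD IHx; congr (_ + _) => {x IHx}.
elim/tensor_ind: y => [|v v' x IHx]; first by rewrite tensor0r tensor0l !linear0.
rewrite tensorDr tensorDl !linearD IHx; congr (_ + _) => {x IHx}.
elim/tensor_ind: z => [|w w' x IHx]; first by rewrite tensor0r !linear0.
by rewrite tensorDr !linearD IHx fg.
Qed.

Lemma tensor8_ext U U' V V' W W' X X' Y
    (f g : {linear ((U \otimes U') \otimes (V \otimes V')) \otimes
                   ((W \otimes W') \otimes (X \otimes X')) -> Y}) :
  (forall u u' v v' w w' x x',
     f ((u \ox u' \ox (v \ox v')) \ox ((w \ox w') \ox (x \ox x'))) =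
     g ((u \ox u' \ox (v \ox v')) \ox ((w \ox w') \ox (x \ox x')))) -> f =1 g.
Proof.
move=> fg; apply: tensorlr_ext => x y z t.
elim/tensor_ind: x => [|u u' x IHx]; first by rewrite !tensor0l !linear0.
rewrite !tensorDl !linearD IHx; congr (_ + _) => {x IHx}.
elim/tensor_ind: y => [|v v' x IHx]; first by rewrite tensor0r tensor0l !linear0.
rewrite tensorDr tensorDl !linearD IHx; congr (_ + _) => {x IHx}.
elim/tensor_ind: z => [|w w' x IHx]; first by rewrite tensor0l tensor0r !linear0.
rewrite tensorDl tensorDr !linearD IHx; congr (_ + _) => {x IHx}.
elim/tensor_ind: t => [|w1 w2 x IHx]; first by rewrite !tensor0r !linear0.
by rewrite !tensorDr !linearD IHx fg.
Qed.

(** The way back from composites of morphisms to Sweedler sums. [G] is a bare function with a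
    linearity hypothesis, so that it can be any abstraction of a tensor inside a term. *)
Lemma tlift_linear_map U V W (G : U \otimes V -> W) t :
  linear G -> G t = \tsum_(u, v <- t) G (u \ox v).
Proof.
move=> lG; have G0 := linear_map0 lG; rewrite {1}[t]tensor_repr /tlift.
elim: (repr t) => [|p s IHs]; first by rewrite !big_nil.
rewrite !big_cons -IHs; have := lG 1 (p.1 \ox p.2) (\sum_(q <- s) q.1 \ox q.2).
by rewrite !scale1r.
Qed.

End TensorExtensionality.

(** * Coalgebra morphisms *)

Section CoalgebraMorphisms.
Variable k : fieldType.
Implicit Types C D E : coalgType k.

Record cmor C D := CMor { cfun :> {linear C -> D}; cmorP : coalg_morph cfun }.

(** Equality of the bundled maps, by functional extensionality and proof irrelevance, so that
    identities between composites can be used for rewriting. *)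
Lemma linear_ext (U V : lmodType k) (f g : {linear U -> V}) : f =1 g -> f = g.
Proof.
case: f g => [f [[fA] [fZ]]] [g [[gA] [gZ]]] /= /funext fg.
case: _ / fg in gA gZ *.
by rewrite (Prop_irrelevance fA gA) (Prop_irrelevance fZ gZ).
Qed.

Lemma cmor_ext C D (f g : cmor C D) : f =1 g -> f = g.
Proof.
case: f g => [f fP] [g gP] /= /linear_ext fg.
by case: _ / fg in gP *; congr CMor; apply: Prop_irrelevance.
Qed.

Lemma cmor_comul C D (f : cmor C D) c : comul (f c) = tmap f f (comul c).
Proof. by case: f => f [] /= ->. Qed.

Lemma cmor_counit C D (f : cmor C D) c : counit (f c) = counit c.
Proof. by case: f => f [] /= _ ->. Qed.

Lemma tmap_comp (U U' U'' V V' V'' : lmodType k) (f : {linear U -> U'})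
    (f' : {linear U' -> U''}) (g : {linear V -> V'}) (g' : {linear V' -> V''}) t :
  tmap f' g' (tmap f g t) = tmap (f' \o f) (g' \o g) t.
Proof.
move: t; apply: (tensor_ext (f := tmap f' g' \o tmap f g)
  (g := tmap (f' \o f) (g' \o g))) => u v.
by rewrite /= !tmapE.
Qed.

Lemma tmap_id (U V : lmodType k) (t : U \otimes V) : tmap idfun idfun t = t.
Proof.
elim/tensor_ind: t => [|u v t IHt]; first by rewrite linear0.
by rewrite linearD /= IHt tmapE.
Qed.

Lemma cmor_id_morph C : coalg_morph (idfun : {linear C -> C}).
Proof. by split=> c //=; rewrite tmap_id. Qed.
Definition cmor_id C : cmor C C := CMor (cmor_id_morph C).

Lemma ccomp_morph C D E (g : cmor D E) (f : cmor C D) :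
  coalg_morph (g \o f : {linear C -> E}).
Proof.
split=> c /=; last by rewrite !cmor_counit.
by rewrite !cmor_comul tmap_comp.
Qed.
Definition ccomp C D E (g : cmor D E) (f : cmor C D) : cmor C E :=
  CMor (ccomp_morph g f).

Lemma tmid_tmap C C' D D' (f : {linear C -> C'}) (g : {linear D -> D'})
    (x : C \otimes C) (y : D \otimes D) :
  tmid (tmap f f x \ox tmap g g y) = tmap (tmap f g) (tmap f g) (tmid (x \ox y)).
Proof.
rewrite -(tmapE (tmap f f) (tmap g g)).
apply: (tensorlr_ext (f := @tmid k _ _ _ _ \o tmap (tmap f f) (tmap g g))
  (g := tmap (tmap f g) (tmap f g) \o @tmid k _ _ _ _)) => c c' d d'.
by rewrite /= tmapE !tmidE !tmapE /= !tmapE tmidE.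
Qed.

Lemma tens_comulE C D (c : C) (d : D) :
  comul (c \ox d) = tmid (comul c \ox comul d).
Proof. by rewrite [LHS]/(tens_comul _) /tens_comul tmapE. Qed.

Lemma tens_counit_pure C D (c : C) (d : D) :
  counit (c \ox d) = counit c * counit d.
Proof. exact: tens_counitE. Qed.

Lemma tens_cmorP C D (E : coalgType k) (f : {linear C \otimes D -> E}) :
  (forall c d, comul (f (c \ox d)) = tmap f f (tmid (comul c \ox comul d))) ->
  (forall c d, counit (f (c \ox d)) = counit c * counit d) ->
  coalg_morph f.
Proof.
move=> fD fe; split; elim/tensor_ind=> [|c d t IHt]; try by rewrite !linear0.
  by rewrite !linearD /= IHt fD tens_comulE.
rewrite !linearD /= IHt fe; congr (_ + _).
by rewrite tens_counit_pure.
Qed.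

Lemma ctens_morph C C' D D' (f : cmor C C') (g : cmor D D') :
  coalg_morph (tmap f g : {linear _ -> _}).
Proof.
apply: tens_cmorP => c d; rewrite /= tmapE.
  by rewrite tens_comulE (cmor_comul f) (cmor_comul g); exact: tmid_tmap.
by rewrite tens_counit_pure !cmor_counit.
Qed.
Definition ctens C C' D D' (f : cmor C C') (g : cmor D D') :
  cmor (C \otimes D) (C' \otimes D') := CMor (ctens_morph f g).

Definition fst_map C D (t : C \otimes D) : C :=
  \tsum_(c, d <- t) counit d *: c.
Definition snd_map C D (t : C \otimes D) : D :=
  \tsum_(c, d <- t) counit c *: d.
HB.instance Definition _ C D :=
  GRing.isLinear.Build k (C \otimes D) C *:%R (@fst_map C D)
    (tlift_linear (@tscale_bilinearr k C D counit)).
HB.instance Definition _ C D :=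
  GRing.isLinear.Build k (C \otimes D) D *:%R (@snd_map C D)
    (tlift_linear (@tscale_bilinearl k C D counit)).

Lemma fst_mapE C D (c : C) (d : D) : fst_map (c \ox d) = counit d *: c.
Proof. exact: (tliftE (tscale_bilinearr _ _)). Qed.
Lemma snd_mapE C D (c : C) (d : D) : snd_map (c \ox d) = counit c *: d.
Proof. exact: (tliftE (tscale_bilinearl _ _)). Qed.

Lemma fst_comul C (c : C) : fst_map (comul c) = c.
Proof. exact: counitr. Qed.
Lemma snd_comul C (c : C) : snd_map (comul c) = c.
Proof. exact: counitl. Qed.

Lemma counit_fst C D (t : C \otimes D) : counit (fst_map t) = counit t.
Proof.
elim/tensor_ind: t => [|c d t IHt]; first by rewrite !linear0.
rewrite !linearD /= IHt fst_mapE linearZ /= mulrC.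
by rewrite tens_counit_pure.
Qed.
Lemma counit_snd C D (t : C \otimes D) : counit (snd_map t) = counit t.
Proof.
elim/tensor_ind: t => [|c d t IHt]; first by rewrite !linear0.
rewrite !linearD /= IHt snd_mapE linearZ /=.
by rewrite tens_counit_pure.
Qed.

Lemma fst_fst_tmid C D (x : C \otimes C) (y : D \otimes D) :
  tmap (@fst_map C D) (@fst_map C D) (tmid (x \ox y)) = counit y *: x.
Proof.
rewrite -fst_mapE.
apply: (tensorlr_ext (f := tmap (@fst_map C D) (@fst_map C D) \o @tmid k _ _ _ _)
  (g := @fst_map _ _)) => c c' d d'.
rewrite /= tmidE tmapE /= !fst_mapE tensorZl tensorZr scalerA.
by rewrite tens_counit_pure.
Qed.

Lemma snd_snd_tmid C D (x : C \otimes C) (y : D \otimes D) :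
  tmap (@snd_map C D) (@snd_map C D) (tmid (x \ox y)) = counit x *: y.
Proof.
rewrite -snd_mapE.
apply: (tensorlr_ext (f := tmap (@snd_map C D) (@snd_map C D) \o @tmid k _ _ _ _)
  (g := @snd_map _ _)) => c c' d d'.
rewrite /= tmidE tmapE /= !snd_mapE tensorZl tensorZr scalerA.
by rewrite tens_counit_pure.
Qed.

Lemma fst_snd_tmid C D (x : C \otimes C) (y : D \otimes D) :
  tmap (@fst_map C D) (@snd_map C D) (tmid (x \ox y)) = fst_map x \ox snd_map y.
Proof.
rewrite -(tmapE (@fst_map C C) (@snd_map D D)).
apply: (tensorlr_ext (f := tmap (@fst_map C D) (@snd_map C D) \o @tmid k _ _ _ _)
  (g := tmap (@fst_map C C) (@snd_map D D))) => c c' d d'.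
rewrite /= tmidE !tmapE /= !(fst_mapE, snd_mapE) !(tensorZl, tensorZr) !scalerA.
by rewrite mulrC.
Qed.

Lemma counit_comul C (c : C) : counit (comul c) = counit c.
Proof. by rewrite -counit_fst fst_comul. Qed.

Lemma cfst_morph C D : coalg_morph (@fst_map C D : {linear _ -> _}).
Proof.
apply: tens_cmorP => c d /=; last by rewrite counit_fst tens_counit_pure.
by rewrite fst_mapE linearZ /= fst_fst_tmid counit_comul.
Qed.
Lemma csnd_morph C D : coalg_morph (@snd_map C D : {linear _ -> _}).
Proof.
apply: tens_cmorP => c d /=; last by rewrite counit_snd tens_counit_pure.
by rewrite snd_mapE linearZ /= snd_snd_tmid counit_comul.
Qed.
Definition cfst C D : cmor (C \otimes D) C := CMor (cfst_morph C D).
Definition csnd C D : cmor (C \otimes D) D := CMor (csnd_morph C D).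

Lemma fst_tmap C C' D D' (f : {linear C -> C'}) (g : cmor D D') t :
  fst_map (tmap f g t) = f (fst_map t).
Proof.
elim/tensor_ind: t => [|c d t IHt]; first by rewrite !linear0.
by rewrite !linearD /= IHt tmapE !fst_mapE cmor_counit linearZ.
Qed.
Lemma snd_tmap C C' D D' (f : cmor C C') (g : {linear D -> D'}) t :
  snd_map (tmap f g t) = g (snd_map t).
Proof.
elim/tensor_ind: t => [|c d t IHt]; first by rewrite !linear0.
by rewrite !linearD /= IHt tmapE !snd_mapE cmor_counit linearZ.
Qed.

Lemma cmor_tens_ext C D (E : coalgType k) (f g : cmor (C \otimes D) E) :
  (forall c d, f (c \ox d) = g (c \ox d)) -> f = g.
Proof. by move=> fg; apply/cmor_ext/tensor_ext. Qed.

(** Uniqueness half of the universal property of a product. Applying the two projections to the two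
    legs of the coproduct of an element of C (x) D gives that element back; since h is a coalgebra
    morphism, h t is thus computed from its two components and the coproduct of t. *)
Lemma cprod_ext (T : coalgType k) C D (f g : cmor T (C \otimes D)) :
  ccomp (cfst C D) f = ccomp (cfst C D) g ->
  ccomp (csnd C D) f = ccomp (csnd C D) g -> f = g.
Proof.
have eta (h : cmor T (C \otimes D)) t : h t =
    tmap (ccomp (cfst C D) h) (ccomp (csnd C D) h) (comul t).
  rewrite -tmap_comp -cmor_comul.
  elim/tensor_ind: (h t) => [|c d s IHs]; first by rewrite !linear0.
  rewrite !linearD /= -IHs; congr (_ + _).
  by rewrite [comul _]tens_comulE fst_snd_tmid fst_comul snd_comul.
by move=> e1 e2; apply: cmor_ext => t; rewrite eta e1 e2 -eta.
Qed.

End CoalgebraMorphisms.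

(** * Products of cocommutative coalgebras *)

Section CocommutativeProducts.
Variable k : fieldType.
Implicit Types C D E T X : coalgType k.

Lemma cswap_morph C D : coalg_morph (@tswap k C D : {linear _ -> _}).
Proof.
apply: tens_cmorP => c d; rewrite /= tswapE; last first.
  by rewrite !tens_counit_pure mulrC.
rewrite tens_comulE -tswapE.
apply: (tensorlr_ext (f := @tmid k _ _ _ _ \o @tswap k _ _)
  (g := tmap (@tswap k C D) (@tswap k C D) \o @tmid k _ _ _ _)) => c1 c2 d1 d2.
by rewrite /= tswapE !tmidE tmapE /= !tswapE.
Qed.
Definition cswap C D : cmor (C \otimes D) (D \otimes C) := CMor (cswap_morph C D).

Lemma tassoc_tmid (U U' V V' W W' : lmodType k) (x : U \otimes U')
    (y : V \otimes V') (z : W \otimes W') :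
  tmap (@tassoc k U V W) (@tassoc k U' V' W') (tmid (tmid (x \ox y) \ox z)) =
  tmid (x \ox tmid (y \ox z)).
Proof.
transitivity ((tmap (@tassoc k U V W) (@tassoc k U' V' W') \o
  (@tmid k _ _ _ _ \o tmap (@tmid k U U' V V') idfun)) (x \ox y \ox z)).
  by rewrite /= tmapE.
transitivity ((@tmid k _ _ _ _ \o
  (tmap idfun (@tmid k V V' W W') \o @tassoc k _ _ _)) (x \ox y \ox z)).
  apply: tensor6_ext => u u' v v' w w'.
  by rewrite /= tassocE !tmapE /= !tmidE tmapE /= !tassocE.
by rewrite /= tassocE tmapE.
Qed.

(** When x, y, z, t are coproducts of elements, this is the compatibility of the interchange with
    comultiplication, as used in [cmid_morph]. *)
Lemma tmid_tmid (U U' V V' W W' X X' : lmodType k) (x : U \otimes U')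
    (y : V \otimes V') (z : W \otimes W') (t : X \otimes X') :
  tmid (tmid (x \ox y) \ox tmid (z \ox t)) =
  tmap (@tmid k U W V X) (@tmid k U' W' V' X')
    (tmid (tmid (x \ox z) \ox tmid (y \ox t))).
Proof.
transitivity ((@tmid k _ _ _ _ \o tmap (@tmid k U U' V V') (@tmid k W W' X X'))
  ((x \ox y) \ox (z \ox t))).
  by rewrite /= tmapE.
transitivity ((tmap (@tmid k U W V X) (@tmid k U' W' V' X') \o
  (@tmid k _ _ _ _ \o (tmap (@tmid k U U' W W') (@tmid k V V' X X') \o
   @tmid k _ _ _ _))) ((x \ox y) \ox (z \ox t))).
  apply: tensor8_ext => u u' v v' w w' t1 t2.
  by rewrite /= !tmidE !tmapE /= !tmidE !tmapE /= !tmidE.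
by rewrite /= tmidE tmapE.
Qed.

Lemma cassoc_morph C D E : coalg_morph (@tassoc k C D E : {linear _ -> _}).
Proof.
apply: tens_cmorP => s e /=.
  elim/tensor_ind: s => [|c d s IHs]; first by rewrite !(tensor0l, linear0).
  rewrite tensorDl !linearD /= tensorDl !linearD /= IHs; congr (_ + _).
  by rewrite tassocE !tens_comulE tassoc_tmid.
elim/tensor_ind: s => [|c d s IHs].
  by rewrite !(tensor0l, linear0) mul0r.
rewrite tensorDl !linearD /= mulrDl IHs; congr (_ + _).
by rewrite tassocE !tens_counit_pure mulrA.
Qed.
Definition cassoc C D E : cmor (C \otimes D \otimes E) (C \otimes (D \otimes E)) :=
  CMor (cassoc_morph C D E).

(** The inverse associator, composed of cyclic rotations of the factors so that it inherits
    linearity from [tassoc] and [tswap]. *)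
Definition tassoc_inv (U V W : lmodType k) (t : U \otimes (V \otimes W)) :
    U \otimes V \otimes W :=
  tswap (tassoc (tswap (tassoc (tswap t)))).

Fact tassoc_inv_linear (U V W : lmodType k) : linear (@tassoc_inv U V W).
Proof. by move=> a x y; rewrite /tassoc_inv !linearP. Qed.
HB.instance Definition _ (U V W : lmodType k) :=
  GRing.isLinear.Build k (U \otimes (V \otimes W)) (U \otimes V \otimes W) *:%R
    (@tassoc_inv U V W) (@tassoc_inv_linear U V W).

Lemma tassoc_invE (U V W : lmodType k) (u : U) (v : V) (w : W) :
  tassoc_inv (u \ox (v \ox w)) = u \ox v \ox w.
Proof. by rewrite /tassoc_inv !(tswapE, tassocE). Qed.

(** The source bracketing keeps the two middle factors together, so that exchanging them is a mere
    [tmap] of [tswap]. *)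
Definition regroup T (t : T \otimes (T \otimes T \otimes T)) :
    (T \otimes T) \otimes (T \otimes T) :=
  tassoc_inv (tmap idfun (@tassoc k T T T) t).

Fact regroup_linear T : linear (@regroup T).
Proof. by move=> a x y; rewrite /regroup !linearP. Qed.
HB.instance Definition _ T :=
  GRing.isLinear.Build k (T \otimes (T \otimes T \otimes T))
    ((T \otimes T) \otimes (T \otimes T)) *:%R (@regroup T) (@regroup_linear T).

Lemma regroupE T (a b c d : T) :
  regroup (a \ox (b \ox c \ox d)) = (a \ox b) \ox (c \ox d).
Proof. by rewrite /regroup tmapE /= tassocE tassoc_invE. Qed.

Lemma tmid_regroup T t :
  tmid (regroup t) = regroup (tmap idfun (tmap (@tswap k T T) idfun) t).
Proof.
move: t; apply: (tensorrl_ext (f := @tmid k _ _ _ _ \o @regroup T)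
  (g := @regroup T \o tmap idfun (tmap (@tswap k T T) idfun))) => a b c d.
by rewrite /= tmapE /= tmapE /= tswapE !regroupE tmidE.
Qed.

Lemma comul_comul T (t : T) :
  tmap comul comul (comul t) =
  regroup (tmap idfun (tmap comul idfun) (tmap idfun comul (comul t))).
Proof.
rewrite /regroup /= !tmap_comp.
(* Coassociativity in the second leg of the coproduct; the outer coproduct is treated afterwards. *)
have -> : tmap (idfun \o (idfun \o idfun))
     (@tassoc k T T T \o (tmap comul idfun \o comul)) (comul t) =
   tmap idfun (tmap idfun comul) (tmap idfun comul (comul t)).
  by rewrite tmap_comp; congr tlift; apply/funext=> u; apply/funext=> v;
    congr (_ \ox _); exact: coassoc.
rewrite -coassoc.
rewrite -[RHS]/((@tassoc_inv _ _ _ \o (tmap idfun (tmap idfun comul) \o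
  @tassoc k T T T)) (tmap comul idfun (comul t))).
(* Naturality of the associator: a coproduct on the last of three factors commutes with
   reassociation. *)
rewrite (_ : _ =1 tmap idfun comul) ?tmap_comp //.
apply: tensorl_ext => a b c.
by rewrite /= tassocE !tmapE /= tmapE tassoc_invE.
Qed.

Variable T : coalgType k.
Hypothesis coT : cocommutative T.

(* By coassociativity both sides list the four legs of the iterated coproduct;
   they differ by a swap of the two middle legs. *)
Lemma cdiag_morph : coalg_morph (comul : {linear T -> T \otimes T}).
Proof.
split=> t; last by rewrite counit_comul.
rewrite [LHS]/(tens_comul _) /tens_comul comul_comul tmid_regroup !tmap_comp.
congr (regroup _); congr tlift; apply/funext=> u; apply/funext=> v /=.
congr (_ \ox _); rewrite tmap_comp; congr tlift; apply/funext=> x; apply/funext=> y /=.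
by rewrite coT.
Qed.
Definition cdiag : cmor T (T \otimes T) := CMor cdiag_morph.

(* [locked] keeps unification from unfolding pairs when rewriting with [ccompA]. *)
Definition cpair C D (f : cmor T C) (g : cmor T D) : cmor T (C \otimes D) :=
  locked (ccomp (ctens f g) cdiag).

Lemma cfst_pair C D (f : cmor T C) (g : cmor T D) : ccomp (cfst C D) (cpair f g) = f.
Proof. by apply: cmor_ext => t; rewrite /cpair -lock /= fst_tmap fst_comul. Qed.
Lemma csnd_pair C D (f : cmor T C) (g : cmor T D) : ccomp (csnd C D) (cpair f g) = g.
Proof. by apply: cmor_ext => t; rewrite /cpair -lock /= snd_tmap snd_comul. Qed.
End CocommutativeProducts.

(** * Calculus of tuples of generalised elements *)

Section CartesianStructure.
Variable k : fieldType.
Implicit Types C D E T X : coalgType k.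

Lemma cocommutative_tens C D :
  cocommutative C -> cocommutative D -> cocommutative (C \otimes D)%type.
Proof.
move=> coC coD; elim/tensor_ind=> [|c d t IHt]; first by rewrite !linear0.
rewrite !linearD /= IHt; congr (_ + _); rewrite tens_comulE.
rewrite -{2}(coC c) -{2}(coD d) -(tmapE (@tswap k C C) (@tswap k D D)).
apply: (tensorlr_ext (f := @tswap k _ _ \o @tmid k _ _ _ _)
  (g := @tmid k _ _ _ _ \o tmap (@tswap k C C) (@tswap k D D))) => c1 c2 d1 d2.
by rewrite /= tmapE /= !tmidE !tswapE tmidE.
Qed.

Lemma cmor_tensl_ext C D E X (f g : cmor (C \otimes D \otimes E) X) :
  (forall c d e, f (c \ox d \ox e) = g (c \ox d \ox e)) -> f = g.
Proof. by move=> fg; apply/cmor_ext/tensorl_ext. Qed.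

Lemma cmor_tenslll_ext C D E C' D' X
    (f g : cmor (C \otimes D \otimes E \otimes C' \otimes D') X) :
  (forall c d e c' d',
    f (c \ox d \ox e \ox c' \ox d') = g (c \ox d \ox e \ox c' \ox d')) -> f = g.
Proof.
move=> fg; apply: cmor_tensl_ext => s c' d'.
elim/tensor_ind: s => [|s e r IHr]; first by rewrite !tensor0l (linear0 f) (linear0 g).
rewrite !tensorDl (linearD f) (linearD g) IHr; congr (_ + _) => {r IHr}.
elim/tensor_ind: s => [|c d s IHs]; first by rewrite !tensor0l (linear0 f) (linear0 g).
by rewrite !tensorDl (linearD f) (linearD g) IHs fg.
Qed.

Lemma ccompE C D E (g : cmor D E) (f : cmor C D) c : ccomp g f c = g (f c).
Proof. by []. Qed.

Lemma ctens_pure C C' D D' (f : cmor C C') (g : cmor D D') c d :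
  ctens f g (c \ox d) = f c \ox g d.
Proof. exact: tmapE. Qed.

Lemma cmor_idE C (c : C) : cmor_id C c = c.
Proof. by []. Qed.

Lemma ccompA C D E E' (h : cmor E E') (g : cmor D E) (f : cmor C D) :
  ccomp h (ccomp g f) = ccomp (ccomp h g) f.
Proof. exact: cmor_ext. Qed.

Lemma ccomp1 C D (f : cmor C D) : ccomp f (cmor_id C) = f.
Proof. exact: cmor_ext. Qed.
Lemma ccomp1l C D (f : cmor C D) : ccomp (cmor_id D) f = f.
Proof. exact: cmor_ext. Qed.

Lemma cpair_comp S T (coS : cocommutative S) (coT : cocommutative T) C D
  (f : cmor T C) (g : cmor T D) (e : cmor S T) :
  ccomp (cpair coT f g) e = cpair coS (ccomp f e) (ccomp g e).
Proof. by apply: cprod_ext; rewrite ccompA !(cfst_pair, csnd_pair). Qed.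

(** This and the later [_pair] lemmas evaluate a structural morphism on a tuple of generalised
    elements; rewriting with them replaces diagram chases. *)
Lemma ctens_pair T (coT : cocommutative T) C C' D D' (f : cmor C C') (g : cmor D D')
    (u : cmor T C) (v : cmor T D) :
  ccomp (ctens f g) (cpair coT u v) = cpair coT (ccomp f u) (ccomp g v).
Proof.
apply: cprod_ext; rewrite !(cfst_pair, csnd_pair) ccompA.
  rewrite -[in RHS](cfst_pair coT u v) ccompA; congr ccomp.
  by apply: cmor_ext => t /=; rewrite fst_tmap.
rewrite -[in RHS](csnd_pair coT u v) ccompA; congr ccomp.
by apply: cmor_ext => t /=; rewrite snd_tmap.
Qed.

Lemma cpair_id C D (co : cocommutative (C \otimes D)%type) :
  cpair co (cfst C D) (csnd C D) = cmor_id (C \otimes D)%type.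
Proof. by apply: cprod_ext; rewrite ccomp1 (cfst_pair, csnd_pair). Qed.

Lemma cpair_eta T (coT : cocommutative T) C D (f : cmor T (C \otimes D)) :
  cpair coT (ccomp (cfst C D) f) (ccomp (csnd C D) f) = f.
Proof. by apply: cprod_ext; rewrite (cfst_pair, csnd_pair). Qed.

Lemma ctensE C C' D D' (co : cocommutative (C \otimes D)%type)
    (f : cmor C C') (g : cmor D D') :
  ctens f g = cpair co (ccomp f (cfst C D)) (ccomp g (csnd C D)).
Proof. by rewrite -ctens_pair cpair_id ccomp1. Qed.

Lemma cdiag_comp T S (coT : cocommutative T) (coS : cocommutative S) (f : cmor T S) :
  ccomp (cdiag coS) f = cpair coT f f.
Proof. by apply: cmor_ext => t; rewrite /cpair -lock /= cmor_comul. Qed.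

Lemma cswap_pair T (coT : cocommutative T) C D (f : cmor T C) (g : cmor T D) :
  ccomp (cswap C D) (cpair coT f g) = cpair coT g f.
Proof.
apply: cprod_ext; rewrite ccompA ?cfst_pair ?csnd_pair.
  rewrite -[RHS](csnd_pair coT f g); congr ccomp; apply: cmor_tens_ext => c d /=.
  by rewrite tswapE fst_mapE snd_mapE.
rewrite -[RHS](cfst_pair coT f g); congr ccomp; apply: cmor_tens_ext => c d /=.
by rewrite tswapE fst_mapE snd_mapE.
Qed.

Lemma cassocE C D E (c : C) (d : D) (e : E) :
  cassoc C D E (c \ox d \ox e) = c \ox (d \ox e).
Proof. exact: tassocE. Qed.

Lemma cswapE C D (c : C) (d : D) : cswap C D (c \ox d) = d \ox c.
Proof. exact: tswapE. Qed.

Lemma cassoc_pair T (coT : cocommutative T) C D E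
    (f : cmor T C) (g : cmor T D) (h : cmor T E) :
  ccomp (cassoc C D E) (cpair coT (cpair coT f g) h) = cpair coT f (cpair coT g h).
Proof.
have e1 : ccomp (cfst _ _) (cassoc C D E) = ccomp (cfst _ _) (cfst _ _).
  apply: cmor_tensl_ext => c d e /=.
  rewrite tassocE !fst_mapE tens_counit_pure linearZ /= fst_mapE scalerA.
  by rewrite mulrC.
have e2 : ccomp (csnd _ _) (cassoc C D E) = ctens (csnd _ _) (cmor_id _).
  apply: cmor_tensl_ext => c d e /=.
  by rewrite tassocE tmapE /= !snd_mapE tensorZl.
apply: cprod_ext; rewrite ccompA ?e1 ?e2.
  by rewrite -ccompA !cfst_pair.
by rewrite ctens_pair !csnd_pair ccomp1l.
Qed.

Lemma tens_cmorlrP (C C' D D' E : coalgType k)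
    (f : {linear (C \otimes C') \otimes (D \otimes D') -> E}) :
  (forall c c' d d', comul (f (c \ox c' \ox (d \ox d'))) =
     tmap f f (tmid (tmid (comul c \ox comul c') \ox tmid (comul d \ox comul d')))) ->
  (forall c c' d d', counit (f (c \ox c' \ox (d \ox d'))) =
     counit c * counit c' * (counit d * counit d')) -> coalg_morph f.
Proof.
move=> fD fe; apply: tens_cmorP => s r.
  elim/tensor_ind: s => [|c c' s IHs]; first by rewrite !(tensor0l, linear0).
  rewrite !tensorDl !linearD IHs /= tensorDl !linearD; congr (_ + _).
  rewrite (tens_comulE c c') => {s IHs}.
  elim/tensor_ind: r => [|d d' s IHs]; first by rewrite !(tensor0r, linear0).
  rewrite !tensorDr !linearD IHs /= tensorDr !linearD; congr (_ + _).
  by rewrite (tens_comulE d d') fD.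
elim/tensor_ind: s => [|c c' s IHs]; first by rewrite !(tensor0l, linear0) mul0r.
rewrite !tensorDl !linearD IHs /= mulrDl; congr (_ + _).
rewrite tens_counit_pure => {s IHs}.
elim/tensor_ind: r => [|d d' s IHs]; first by rewrite !(tensor0r, linear0) mulr0.
rewrite !tensorDr !linearD IHs /= mulrDr; congr (_ + _).
by rewrite tens_counit_pure fe.
Qed.

Lemma cmid_morph C C' D D' : coalg_morph (@tmid k C C' D D' : {linear _ -> _}).
Proof.
apply: tens_cmorlrP => c c' d d' /=; last first.
  by rewrite tmidE !tens_counit_pure mulrACA.
rewrite tmidE tens_comulE.
rewrite (tens_comulE c d) (tens_comulE c' d').
exact: tmid_tmid.
Qed.
Definition cmid C C' D D' :
  cmor ((C \otimes C') \otimes (D \otimes D')) ((C \otimes D) \otimes (C' \otimes D')) :=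
  CMor (cmid_morph C C' D D').

Lemma cmidE C C' D D' (c : C) (c' : C') (d : D) (d' : D') :
  cmid C C' D D' ((c \ox c') \ox (d \ox d')) = (c \ox d) \ox (c' \ox d').
Proof. exact: tmidE. Qed.

Lemma cmid_pair T (coT : cocommutative T) C C' D D' (f : cmor T C)
    (f' : cmor T C') (g : cmor T D) (g' : cmor T D') :
  ccomp (cmid C C' D D') (cpair coT (cpair coT f f') (cpair coT g g')) =
  cpair coT (cpair coT f g) (cpair coT f' g').
Proof.
have e1 : ccomp (cfst _ _) (cmid C C' D D') = ctens (cfst _ _) (cfst _ _).
  apply: cmor_ext; apply: tensorlr_ext => c c' d d' /=.
  by rewrite tmidE tmapE /= !fst_mapE tens_counit_pure tensorZl tensorZr scalerA.
have e2 : ccomp (csnd _ _) (cmid C C' D D') = ctens (csnd _ _) (csnd _ _).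
  apply: cmor_ext; apply: tensorlr_ext => c c' d d' /=.
  by rewrite tmidE tmapE /= !snd_mapE tens_counit_pure tensorZl tensorZr scalerA.
by apply: cprod_ext; rewrite ccompA ?e1 ?e2 ctens_pair ?cfst_pair ?csnd_pair.
Qed.

End CartesianStructure.

(** * The heap of morphisms into a Hopf heap *)

Section HeapOfMorphisms.
Variables (k : fieldType) (H : coalgType k).
Variable br : {linear H \otimes cop H \otimes H -> H}.
Hypothesis H_heap : hopf_heap br.
Hypothesis coH : cocommutative H.
Implicit Types S T : coalgType k.

(** The identity is named in order to carry a linear structure towards [cop H]; cocommutativity
    makes it a coalgebra morphism. *)
Definition to_cop (x : H) : cop H := x.
Fact to_cop_linear : linear to_cop.
Proof. by []. Qed.
HB.instance Definition _ :=
  GRing.isLinear.Build k H (cop H) *:%R to_cop to_cop_linear.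

Lemma to_cop_morph : coalg_morph (to_cop : {linear H -> cop H}).
Proof.
split=> c //; rewrite [LHS]/(cop_comul _) /cop_comul coH.
exact: (esym (tmap_id (comul c))).
Qed.

(* The bracket without [cop] in its domain, which cocommutativity allows. *)
Definition cbr : cmor (H \otimes H \otimes H) H :=
  locked (ccomp (CMor (hopf_heap_coalg H_heap))
    (ctens (ctens (cmor_id H) (CMor to_cop_morph)) (cmor_id H))).

Lemma cbrE a b c : cbr (a \ox b \ox c) = hb br a b c.
Proof. by rewrite /cbr -lock ccompE !ctens_pure. Qed.

(** In Sweedler notation this is the convolution bracket sending t to [f t1, g t2, h t3]. *)
Definition hbr T (coT : cocommutative T) (f g h : cmor T H) : cmor T H :=
  ccomp cbr (cpair coT (cpair coT f g) h).

Lemma hbr_comp S T (coS : cocommutative S) (coT : cocommutative T)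
    (f g h : cmor T H) (e : cmor S T) :
  ccomp (hbr coT f g h) e = hbr coS (ccomp f e) (ccomp g e) (ccomp h e).
Proof. by rewrite /hbr -ccompA !(cpair_comp coS). Qed.

Lemma cbr_sweedler (t : H \otimes H) (a : H) :
  cbr (t \ox a) = \tsum_(x, y <- t) hb br x y a.
Proof.
rewrite (tlift_linear_map (G := fun s => cbr (s \ox a))) => [|u x y].
  by congr tlift; apply/funext=> x; apply/funext=> y; rewrite cbrE.
by rewrite tensorDl tensorZl linearP.
Qed.

Variables (T : coalgType k) (coT : cocommutative T).

(** The pair of f with itself is f followed by the diagonal of H, so the claim reduces to the left
    Malcev identity on pure tensors; its value [counit c *: a] is the second projection. *)
Lemma hbrK (f h : cmor T H) : hbr coT f f h = h.
Proof.
rewrite /hbr -(cdiag_comp coT coH) -(ccomp1l h) -ctens_pair ccompA.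
rewrite ccomp1l -[RHS](csnd_pair coT f h); congr ccomp.
apply: cmor_tens_ext => c a.
rewrite ccompE ctens_pure cbr_sweedler cmor_idE (hopf_heap_malcevl H_heap).
by rewrite -snd_mapE.
Qed.

(** Both sides are a fixed morphism on the fivefold tensor power of H composed with the same tuple.
    Dropping the tuple leaves an identity on pure tensors, which is the associativity of [br]. The
    next two lemmas are proved in the same way. *)
Lemma hbrA (a b c d e : cmor T H) :
  hbr coT (hbr coT a b c) d e = hbr coT a b (hbr coT c d e).
Proof.
rewrite /hbr.
have -> : cpair coT (ccomp cbr (cpair coT (cpair coT a b) c)) d =
    ccomp (ctens cbr (cmor_id H)) (cpair coT (cpair coT (cpair coT a b) c) d).
  by rewrite ctens_pair ccomp1l.
rewrite -[e in LHS]ccomp1l -ctens_pair.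
have -> : cpair coT (cpair coT a b) (ccomp cbr (cpair coT (cpair coT c d) e)) =
    ccomp (ctens (cmor_id _) cbr) (ccomp (cassoc _ _ _)
      (ccomp (ctens (cassoc _ _ _) (cmor_id _))
        (cpair coT (cpair coT (cpair coT (cpair coT a b) c) d) e))).
  by rewrite ctens_pair !cassoc_pair ctens_pair !ccomp1l.
move: (cpair _ _ e) => p.
rewrite !ccompA; congr (ccomp _ p); apply: cmor_tenslll_ext => u v w w' w''.
transitivity (hb br (hb br u v w) w' w'').
  by rewrite ccompE 2!ctens_pure 2!cmor_idE 2!cbrE.
rewrite (hopf_heap_assoc H_heap).
by rewrite 3!ccompE ctens_pure 2!cassocE ctens_pure 2!cmor_idE 2!cbrE.
Qed.

Lemma hbrC : heap_commutative br -> forall a b c : cmor T H,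
  hbr coT a b c = hbr coT c b a.
Proof.
move=> br_comm a b c; rewrite /hbr.
(* Reversal of three factors: reassociate, move the first one to the end, then swap the remaining
   two. *)
have -> : cpair coT (cpair coT c b) a =
    ccomp (ctens (cswap _ _) (cmor_id _)) (ccomp (cswap _ _) (ccomp (cassoc _ _ _)
      (cpair coT (cpair coT a b) c))).
  by rewrite cassoc_pair cswap_pair ctens_pair cswap_pair ccomp1l.
move: (cpair _ (cpair _ a b) c) => p.
rewrite !ccompA; congr (ccomp _ p); apply: cmor_tensl_ext => u v w.
transitivity (hb br w v u); first by rewrite cbrE br_comm.
by rewrite -cbrE !(ccompE, cassocE, cswapE, ctens_pure, cmor_idE).
Qed.

Lemma hbr_morph (al : cmor H H) :
  (forall a b c, al (hb br a b c) = hb br (al a) (al b) (al c)) ->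
  forall a b c : cmor T H,
  ccomp al (hbr coT a b c) = hbr coT (ccomp al a) (ccomp al b) (ccomp al c).
Proof.
move=> alP a b c; rewrite /hbr -!ctens_pair.
move: (cpair _ _ _) => p; rewrite !ccompA; congr (ccomp _ p).
apply: cmor_tensl_ext => u v w.
transitivity (al (hb br u v w)); first by rewrite -cbrE.
by rewrite alP -cbrE !(ccompE, ctens_pure).
Qed.

End HeapOfMorphisms.

(** * Hopf trusses *)

Section Trusses.
Variables (k : fieldType) (H : coalgType k).
Variable br : {linear H \otimes cop H \otimes H -> H}.
Hypothesis H_heap : hopf_heap br.
Hypothesis coH : cocommutative H.

Local Notation coHH := (cocommutative_tens coH coH).
Local Notation coHHH := (cocommutative_tens coHH coH).
Local Notation coX := (cocommutative_tens coH coHHH).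
Local Notation bk := (hbr H_heap coH).

(** Associativity on elements is the hypothesis on generalised elements at the three projections of
    the triple tensor power, evaluated at a pure tensor. *)
Lemma nonunital_bialgebra_cmor (M : cmor (H \otimes H) H) (op : H -> H -> H) :
  (forall x y, M (x \ox y) = op x y) ->
  (forall a b c : cmor (H \otimes H \otimes H) H,
    ccomp M (cpair coHHH a (ccomp M (cpair coHHH b c))) =
    ccomp M (cpair coHHH (ccomp M (cpair coHHH a b)) c)) ->
  nonunital_bialgebra op.
Proof.
move=> ME MA; split; last by exists (cfun M); first exact: cmorP.
move=> x y z; rewrite -!ME.
have e : ccomp M (ccomp (ctens (cmor_id _) M) (cassoc H H H)) =
    ccomp M (ctens M (cmor_id _)).
  (* The identity is inserted and expanded into the tuple of projections. *)
  rewrite -[LHS]ccomp1 -[RHS]ccomp1 -(cpair_id coHHH).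
  rewrite -(cpair_eta coHHH (cfst _ _)) -!ccompA cassoc_pair !ctens_pair !ccomp1l.
  exact: MA.
have := congr1 (fun f : cmor _ _ => f (x \ox y \ox z)) e.
by rewrite !(ccompE, cassocE, ctens_pure, cmor_idE).
Qed.

Lemma hopf_truss_cmor (M : cmor (H \otimes H) H) (op : H -> H -> H) :
  (forall x y, M (x \ox y) = op x y) ->
  (forall a b c : cmor (H \otimes H \otimes H) H,
    ccomp M (cpair coHHH a (ccomp M (cpair coHHH b c))) =
    ccomp M (cpair coHHH (ccomp M (cpair coHHH a b)) c)) ->
  (forall a b c d : cmor (H \otimes (H \otimes H \otimes H)) H,
    ccomp M (cpair coX a (bk coX b c d)) =
    bk coX (ccomp M (cpair coX a b)) (ccomp M (cpair coX a c))
      (ccomp M (cpair coX a d))) ->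
  hopf_truss br op.
Proof.
move=> ME MA MD; split=> //; first exact: nonunital_bialgebra_cmor ME MA.
move=> a b c d.
(* [N] sends (a1, a2, a3), (b, c, d) to the bracket of the three products; two interchanges pair
   each ai with its partner. *)
pose N : cmor (H \otimes H \otimes H \otimes (H \otimes H \otimes H)) H :=
  ccomp (cbr H_heap coH) (ccomp (ctens (ctens M M) M)
    (ccomp (ctens (cmid H H H H) (cmor_id _)) (cmid _ _ _ _))).
have NE s a3 : N (s \ox a3 \ox (b \ox c \ox d)) =
    \tsum_(a1, a2 <- s) hb br (op a1 b) (op a2 c) (op a3 d).
  pose G s := N (s \ox a3 \ox (b \ox c \ox d)).
  rewrite -[LHS]/(G s) (tlift_linear_map (G := G)) => [|u x y].
    congr tlift; apply/funext=> x; apply/funext=> y.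
    rewrite -!ME -(cbrE H_heap coH) /G /N.
    by rewrite !(ccompE, cmidE, ctens_pure, cmor_idE).
  by rewrite /G !(tensorDl, tensorZl) linearP.
(* The iterated coproduct, bracketed like the nested sums in [hopf_truss_distr]. *)
pose L : cmor H (H \otimes H \otimes H) :=
  ccomp (ctens (cdiag coH) (cmor_id H)) (cdiag coH).
(* Distributivity as an equation of morphisms: at the tuple of the four projections it is the
   hypothesis [MD]. *)
have e : ccomp M (ctens (cmor_id H) (cbr H_heap coH)) =
    ccomp N (ctens L (cmor_id _)).
  rewrite -[LHS]ccomp1 -[RHS]ccomp1 -(cpair_id coX).
  set x := cfst _ _; set w := csnd _ _.
  rewrite -(cpair_eta coX w) -(cpair_eta coX (ccomp (cfst _ _) w)).
  rewrite /N -!ccompA !ctens_pair !ccomp1l.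
  rewrite -!ccompA !(cdiag_comp coX) !ctens_pair !ccomp1l !(cdiag_comp coX).
  rewrite !cmid_pair !ctens_pair !ccomp1l !cmid_pair !ctens_pair.
  exact: MD.
have := congr1 (fun f : cmor _ _ => f (a \ox (b \ox c \ox d))) e.
rewrite ccompE ctens_pure cmor_idE cbrE ME => ->.
rewrite ccompE ctens_pure cmor_idE -[L a]/(ctens (cdiag coH) (cmor_id H) (comul a)).
rewrite (tlift_linear_map (G := fun s => N (ctens (cdiag coH) (cmor_id H) s \ox
  (b \ox c \ox d)))) => [|u x y]; last by rewrite linearP tensorDl tensorZl linearP.
congr tlift; apply/funext=> s; apply/funext=> a3.
by rewrite ctens_pure NE.
Qed.

(** * The two products defined by an idempotent endomorphism *)

Hypothesis br_comm : heap_commutative br.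
Variable al : cmor H H.
Hypothesis al_br : forall a b c, al (hb br a b c) = hb br (al a) (al b) (al c).
Hypothesis al_idem : forall a, al (al a) = al a.

(** The universal case: the product of the two projections. Naturality of the bracket ([hbr_comp])
    then yields the product of any two generalised elements. *)
Definition cmul : cmor (H \otimes H) H :=
  bk coHH (cfst H H) (ccomp al (cfst H H)) (csnd H H).

Lemma cmul_pair T (coT : cocommutative T) (f g : cmor T H) :
  ccomp cmul (cpair coT f g) = bk coT f (ccomp al f) g.
Proof. by rewrite [LHS](hbr_comp _ _ coT) -ccompA cfst_pair csnd_pair. Qed.

Lemma cmulE x y : cmul (x \ox y) = alpha_mull br al x y.
Proof.
have -> : cmul = ccomp (cbr H_heap coH)
    (ctens (ccomp (ctens (cmor_id H) al) (cdiag coH)) (cmor_id H)).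
  by rewrite (ctensE coHH) ccomp1l -ccompA (cdiag_comp coHH) ctens_pair ccomp1l.
rewrite ccompE ctens_pure ccompE cmor_idE -[cdiag coH x]/(comul x).
rewrite (tlift_linear_map (G := fun t => cbr H_heap coH (ctens (cmor_id H) al t \ox y))).
  by congr tlift; apply/funext=> u; apply/funext=> v; rewrite ctens_pure cbrE.
by move=> u s t; rewrite linearP tensorDl tensorZl linearP.
Qed.

(** Commutativity turns [x, al y1, y2] into [y2, al y1, x], and cocommutativity exchanges y1 and
    y2. *)
Lemma alpha_mulrE x y : alpha_mulr br al x y = alpha_mull br al y x.
Proof.
rewrite /alpha_mulr /alpha_mull -[in LHS](coH y).
pose F (u v : H) := hb br u (al v) x.
(* The sums are computed on chosen representatives, so exchanging the legs requires bilinearity. *)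
have bF : bilinear_map F.
  split=> [v|u] c a b; rewrite /F /hb.
    by rewrite !(tensorDl, tensorZl) linearP.
  by rewrite linearP !(tensorDr, tensorZr, tensorDl, tensorZl) linearP.
transitivity (\tsum_(u, v <- tswap (comul y)) F v u).
  by congr tlift; apply/funext=> u; apply/funext=> v; rewrite br_comm.
elim/tensor_ind: (comul y) => [|u v t IHt].
  have bF' : bilinear_map (fun u v => F v u) by case: bF.
  by rewrite linear0 /= !tlift0.
have bF' : bilinear_map (fun u v => F v u) by case: bF.
by rewrite linearD /= !tliftD // IHt tswapE !tliftE.
Qed.

Lemma al_comp_idem T (f : cmor T H) : ccomp al (ccomp al f) = ccomp al f.
Proof. by apply: cmor_ext => t; rewrite !ccompE al_idem. Qed.

(** Composition with [al] is an idempotent endomorphism of the abelian heap of generalised elements,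
    so the abstract heap identities apply directly. *)
Lemma alpha_mull_truss : hopf_truss br (alpha_mull br al).
Proof.
apply: (hopf_truss_cmor cmulE) => [a b c|a b c d]; rewrite !cmul_pair.
  exact: (heap_mulA (hbrA H_heap coH coHHH) (hbrK H_heap coH coHHH)
    (hbr_morph H_heap coH coHHH al_br) (@al_comp_idem _)).
exact: (heap_mulDr (hbrA H_heap coH coX) (hbrC H_heap coH coX br_comm)
  (hbrK H_heap coH coX) (ccomp al)).
Qed.

(** The product is represented by [cmul] after the swap. Associativity is therefore read backwards,
    and left distributivity becomes right distributivity of the first product. *)
Lemma alpha_mulr_truss : hopf_truss br (alpha_mulr br al).
Proof.
have ME x y : ccomp cmul (cswap H H) (x \ox y) = alpha_mulr br al x y.
  by rewrite ccompE cswapE cmulE alpha_mulrE.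
have MP T (coT : cocommutative T) (f g : cmor T H) :
    ccomp (ccomp cmul (cswap H H)) (cpair coT f g) = bk coT g (ccomp al g) f.
  by rewrite -ccompA cswap_pair cmul_pair.
apply: (hopf_truss_cmor ME) => [a b c|a b c d]; rewrite !MP.
  exact/esym/(heap_mulA (hbrA H_heap coH coHHH) (hbrK H_heap coH coHHH)
    (hbr_morph H_heap coH coHHH al_br) (@al_comp_idem _)).
exact: (heap_mulDl (hbrA H_heap coH coX) (hbrC H_heap coH coX br_comm)
  (hbrK H_heap coH coX) (hbr_morph H_heap coH coX al_br)).
Qed.

End Trusses.

Unset Implicit Arguments.

Theorem lemma3p9 (k : fieldType) (H : coalgType k)
    (H_grouplike : exists g : H, grouplike g)
    (br : {linear H \otimes cop H \otimes H -> H})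
    (H_heap : hopf_heap br)
    (br_comm : heap_commutative br)
    (H_cocomm : cocommutative H)
    (alpha : {linear H -> H})
    (alpha_morph : hopf_heap_morph br br alpha)
    (alpha_idem : forall x : H, alpha (alpha x) = alpha x) :
  hopf_truss br (alpha_mull br alpha) /\ hopf_truss br (alpha_mulr br alpha).
Proof.
case: alpha_morph => al_coalg al_br; split.
  exact: (alpha_mull_truss H_heap H_cocomm br_comm (al := CMor al_coalg)).
exact: (alpha_mulr_truss H_heap H_cocomm br_comm (al := CMor al_coalg)).
Qed.
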